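(* For every $\Gamma\cup\{\phi\}\subseteq\mathcal{L}_{\triangledown}$: $\Gamma\vdash_{\mathsf{iM}}\phi \iff \Gamma^{\Box}\vdash_{\mathsf{WM}}\phi^{\Box}\iff\Gamma^{\Box}\vdash_{\mathsf{IM}}\phi^{\Box}$.
   Context: $\mathcal{L}_{\triangledown}$: formulas $\phi ::= p_i \mid \bot \mid \phi\wedge\phi \mid \phi\vee\phi \mid \phi\to\phi \mid \triangledown\phi$; $\mathcal{L}_{\Box\Diamond}$: formulas $\phi ::= p_i \mid \bot \mid \phi\wedge\phi \mid \phi\vee\phi \mid \phi\to\phi \mid \Box\phi\mid\Diamond\phi$, over the same countable set of proposition letters; $\neg\phi:=\phi\to\bot$, $\top:=\neg\bot$. For $\phi\in\mathcal{L}_{\triangledown}$, $\phi^{\Box}\in\mathcal{L}_{\Box\Diamond}$ replaces every $\triangledown$ by $\Box$; $\Gamma^{\Box}=\{\psi^{\Box}\mid\psi\in\Gamma\}$. Generalised Hilbert calculi: given a set $\mathscr{Ax}$ of formulas (always including all substitution instances of a standard axiomatisation of intuitionistic propositional logic), derivable consecutions $\Gamma\vdash\phi$ are generated by (El) $\Gamma\vdash\phi$ for $\phi\in\Gamma$; (Ax) $\Gamma\vdash\psi$ for $\psi\in\mathscr{Ax}$; (MP) from $\Gamma\vdash\phi$ and $\Gamma\vdash\phi\to\psi$ infer $\Gamma\vdash\psi$; and for each modality $\heartsuit$ of the language, (Mon$_\heartsuit$) from $\emptyset\vdash\phi\to\psi$ infer $\Gamma\vdash\heartsuit\phi\to\heartsuit\psi$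 (any $\Gamma$). $\mathsf{iM}$: language $\mathcal{L}_{\triangledown}$, no extra axioms. $\mathsf{WM}$: language $\mathcal{L}_{\Box\Diamond}$, extra axioms all substitution instances of $(\Box p\wedge\Diamond\neg p)\to\bot$. $\mathsf{IM}$: language $\mathcal{L}_{\Box\Diamond}$, extra axioms all substitution instances of $(\Box p\wedge\Diamond\neg p)\to\bot$ and $(\Box\top\to\Diamond p)\to\Diamond p$. *)

(* Defs.v *)
From Stdlib Require Export Ensembles Image.

Set Implicit Arguments.
Unset Strict Implicit.

(* Formulas over the proposition letters [Var 0, Var 1, ...], with one unary
   modal operator [Mod m] for each [m : M]. *)
Inductive form (M : Type) : Type :=
| Var (i : nat)
| Bot
| And (a b : form M)
| Or (a b : form M)
| Imp (a b : form M)
| Mod (m : M) (a : form M).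

Arguments Var {M} i.
Arguments Bot {M}.

Declare Scope form_scope.
Delimit Scope form_scope with form.
Bind Scope form_scope with form.
Open Scope form_scope.
Notation "a && b" := (And a b) : form_scope.
Notation "a || b" := (Or a b) : form_scope.
Notation "a ~> b" := (Imp a b) (at level 55, right associativity) : form_scope.

Definition Neg (M : Type) (a : form M) : form M := a ~> Bot.
Definition Top (M : Type) : form M := Neg Bot.
Arguments Top {M}.

Fixpoint subst (M : Type) (s : nat -> form M) (a : form M) : form M :=
  match a with
  | Var i => s i
  | Bot => Bot
  | And b c => And (subst s b) (subst s c)
  | Or b c => Or (subst s b) (subst s c)
  | Imp b c => Imp (subst s b) (subst s c)
  | Mod m b => Mod m (subst s b)
  end.

Definition instances (M : Type) (A : Ensemble (form M)) : Ensemble (form M) :=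
  fun b => exists a s, In _ A a /\ b = subst s a.

Section Hilbert.
Variable M : Type.
Let p : form M := Var 0.
Let q : form M := Var 1.
Let r : form M := Var 2.

Inductive IPC : Ensemble (form M) :=
| IPC_K : IPC (p ~> q ~> p)
| IPC_S : IPC ((p ~> q ~> r) ~> (p ~> q) ~> p ~> r)
| IPC_andl : IPC (p && q ~> p)
| IPC_andr : IPC (p && q ~> q)
| IPC_and : IPC (p ~> q ~> p && q)
| IPC_orl : IPC (p ~> p || q)
| IPC_orr : IPC (q ~> p || q)
| IPC_or : IPC ((p ~> r) ~> (q ~> r) ~> p || q ~> r)
| IPC_bot : IPC (Bot ~> p).

(* [deriv Ax G a] is the derivability of the consecution G |- a in the
   calculus whose axioms are exactly the formulas in [Ax]. *)
Inductive deriv (Ax : Ensemble (form M)) : Ensemble (form M) -> form M -> Prop :=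
| El G a : In _ G a -> deriv Ax G a
| AxR G a : In _ Ax a -> deriv Ax G a
| MP G a b : deriv Ax G a -> deriv Ax G (a ~> b) -> deriv Ax G b
| Mon G m a b :
    deriv Ax (Empty_set _) (a ~> b) -> deriv Ax G (Mod m a ~> Mod m b).

Definition calculus (X : Ensemble (form M)) : Ensemble (form M) -> form M -> Prop :=
  deriv (instances (Union _ IPC X)).
End Hilbert.

Inductive tri_mod : Type := tri.
Inductive boxdia_mod : Type := box | dia.

Definition Ltri : Type := form tri_mod.
Definition Lboxdia : Type := form boxdia_mod.

Definition Box (a : Lboxdia) : Lboxdia := Mod box a.
Definition Dia (a : Lboxdia) : Lboxdia := Mod dia a.

Definition ax_neg : Lboxdia := Box (Var 0) && Dia (Neg (Var 0)) ~> Bot.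
Definition ax_top : Lboxdia := (Box Top ~> Dia (Var 0)) ~> Dia (Var 0).

Definition iM : Ensemble Ltri -> Ltri -> Prop :=
  calculus (Empty_set _).
Definition WM : Ensemble Lboxdia -> Lboxdia -> Prop :=
  calculus (Singleton _ ax_neg).
Definition IM : Ensemble Lboxdia -> Lboxdia -> Prop :=
  calculus (Couple _ ax_neg ax_top).

Fixpoint boxed (a : Ltri) : Lboxdia :=
  match a with
  | Var i => Var i
  | Bot => Bot
  | And b c => And (boxed b) (boxed c)
  | Or b c => Or (boxed b) (boxed c)
  | Imp b c => Imp (boxed b) (boxed c)
  | Mod _ b => Box (boxed b)
  end.

Definition boxed_set (G : Ensemble Ltri) : Ensemble Lboxdia := Im _ _ G boxed.

(* Main.v *)
Require Import Defs.

Set Implicit Arguments.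

(** The only step with content is the conservativity of [IM] over [iM]:
    reading [Dia a] as [¬ ▽ ¬ a] turns every [IM]-derivation into an
    [iM]-derivation and undoes [boxed].  Monotonicity of [Dia] is contraposition
    twice; [ax_neg] becomes [▽ p ∧ ¬ ▽ ¬ ¬ p -> ⊥], which holds because
    [▽ p -> ▽ ¬ ¬ p]; and [ax_top] becomes [(▽ ⊤ -> ¬ ▽ ¬ p) -> ¬ ▽ ¬ p], which
    holds because [▽ ¬ p -> ▽ ⊤]. *)

Section Calculus.
Variables (M : Type) (X : Ensemble (form M)).
Implicit Types (G : Ensemble (form M)) (a b c : form M).

Lemma calculus_IPC G (s : nat -> form M) a :
  IPC a -> calculus X G (subst s a).
Proof. intros Ha. apply AxR. exists a, s. split; [now left | reflexivity]. Qed.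

(** The [IPC] schemas use only the letters 0, 1 and 2. [Bot] serves as a filler value when a schema
    has no third letter. *)
Definition inst3 a b c (i : nat) : form M :=
  match i with 0 => a | 1 => b | _ => c end.

Lemma calculus_const G a b : calculus X G b -> calculus X G (a ~> b).
Proof.
intros Hb. exact (MP Hb (calculus_IPC G (inst3 b a Bot) (@IPC_K _))).
Qed.

Lemma calculus_imp_refl G a : calculus X G (a ~> a).
Proof.
apply MP with (a ~> a ~> a).
- exact (calculus_IPC G (inst3 a a Bot) (@IPC_K _)).
- apply MP with (a ~> (a ~> a) ~> a).
  + exact (calculus_IPC G (inst3 a (a ~> a) Bot) (@IPC_K _)).
  + exact (calculus_IPC G (inst3 a (a ~> a) a) (@IPC_S _)).
Qed.

(** The modal rule is no obstacle: its premise has an empty context, so its conclusion is already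
    derivable over [G] without [a], and [calculus_const] prefixes [a]. *)
Lemma calculus_deduction G a b :
  calculus X (Add _ G a) b -> calculus X G (a ~> b).
Proof.
unfold calculus. intros Hb.
remember (Add _ G a) as H eqn:HH.
induction Hb as [H b Hb | H b Hb | H b c _ IHb _ IHc | H m b c Hbc _]; subst H.
- destruct Hb as [b Hb | b Hb].
  + now apply calculus_const, El.
  + destruct Hb. apply calculus_imp_refl.
- now apply calculus_const, AxR.
- refine (MP (IHb eq_refl) (MP (IHc eq_refl) _)).
  exact (calculus_IPC G (inst3 a b c) (@IPC_S _)).
- now apply calculus_const, Mon.
Qed.

Lemma calculus_weaken G H a :
  Included _ G H -> calculus X G a -> calculus X H a.
Proof.
intros GH Ha. induction Ha as [G a Ha | G a Ha | G a b _ IHa _ IHb | G m a b Hab _].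
- now apply El, GH.
- now apply AxR.
- exact (MP (IHa GH) (IHb GH)).
- now apply Mon.
Qed.

Lemma calculus_imp_trans G a b c :
  calculus X G (a ~> b) -> calculus X G (b ~> c) -> calculus X G (a ~> c).
Proof.
intros Hab Hbc.
refine (MP Hab (MP (calculus_const a Hbc) _)).
exact (calculus_IPC G (inst3 a b c) (@IPC_S _)).
Qed.

Lemma calculus_neg_mono G a b :
  calculus X G (a ~> b) -> calculus X G (Neg b ~> Neg a).
Proof.
intros Hab. apply calculus_deduction. apply calculus_imp_trans with b.
- revert Hab. apply calculus_weaken. now left.
- apply El. right. constructor.
Qed.

Lemma calculus_dneg_intro G a : calculus X G (a ~> Neg (Neg a)).
Proof.
do 2 apply calculus_deduction. apply MP with a; apply El.
- left. right. constructor.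
- right. constructor.
Qed.

End Calculus.

(** Letters and modalities are left unconstrained: the images of letters are absorbed into a
    substitution, and modalities are treated separately in [calculus_map]. *)
Record intuitionistic_hom (M N : Type) (f : form M -> form N) : Prop := {
  hom_Bot : f Bot = Bot;
  hom_And : forall a b, f (a && b) = (f a && f b);
  hom_Or : forall a b, f (a || b) = (f a || f b);
  hom_Imp : forall a b, f (a ~> b) = (f a ~> f b) }.

Lemma intuitionistic_hom_IPC (M N : Type) (f : form M -> form N)
    (s : nat -> form M) (a : form M) :
  intuitionistic_hom f -> IPC a ->
  exists b, IPC b /\ f (subst s a) = subst (fun i => f (s i)) b.
Proof.
intros [fBot fAnd fOr fImp] Ha.
destruct Ha; cbn; rewrite ?fImp, ?fAnd, ?fOr, ?fBot;
  (* The witness is the same schema over [N]: [constructor] backtracks through the schemas until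
     [reflexivity] succeeds. *)
  (eexists; split; [constructor | reflexivity]).
Qed.

(** Common core of the three implications between the calculi. The target context [H] is any set
    containing the image of [G], so that the induction hypothesis for the modal rule can be used at
    the empty context. *)
Lemma calculus_map (M N : Type) (f : form M -> form N)
    (X : Ensemble (form M)) (Y : Ensemble (form N)) :
  intuitionistic_hom f ->
  (forall G s a, In _ X a -> calculus Y G (f (subst s a))) ->
  (forall G m a b, calculus Y (Empty_set _) (f a ~> f b) ->
     calculus Y G (f (Mod m a) ~> f (Mod m b))) ->
  forall G H a, (forall b, In _ G b -> In _ H (f b)) ->
  calculus X G a -> calculus Y H (f a).
Proof.
intros Hf fX fMon G H a GH Ha. revert H GH.
induction Ha as [G a Ha | G a Ha | G a b _ IHa _ IHb | G m a b _ IH]; intros H GH.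
- now apply El, GH.
- destruct Ha as (b & s & [c Hc | c Hc] & ->).
  + destruct (intuitionistic_hom_IPC s Hf Hc) as (d & Hd & ->).
    now apply calculus_IPC.
  + now apply fX.
- apply MP with (f a); [now apply IHa |].
  rewrite <- (hom_Imp Hf). now apply IHb.
- rewrite (hom_Imp Hf). apply fMon. rewrite <- (hom_Imp Hf). apply IH.
  intros c [].
Qed.

Fixpoint unbox (a : Lboxdia) : Ltri :=
  match a with
  | Var i => Var i
  | Bot => Bot
  | And b c => And (unbox b) (unbox c)
  | Or b c => Or (unbox b) (unbox c)
  | Imp b c => Imp (unbox b) (unbox c)
  | Mod box b => Mod tri (unbox b)
  | Mod dia b => Neg (Mod tri (Neg (unbox b)))
  end.

Lemma unbox_boxed a : unbox (boxed a) = a.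
Proof. induction a as [| | | | | []]; cbn; congruence. Qed.

Lemma unbox_ax_neg G s : iM G (unbox (subst s ax_neg)).
Proof.
cbn. set (p := unbox (s 0)). set (nn := Neg (Mod tri (Neg (Neg p)))).
apply calculus_deduction.
assert (Hconj : iM (Add _ G (Mod tri p && nn)) (Mod tri p && nn)).
{ apply El. right. constructor. }
apply MP with (Mod tri (Neg (Neg p))).
- apply MP with (Mod tri p).
  + exact (MP Hconj (calculus_IPC _ _ (inst3 (Mod tri p) nn Bot) (@IPC_andl _))).
  + apply Mon, calculus_dneg_intro.
- exact (MP Hconj (calculus_IPC _ _ (inst3 (Mod tri p) nn Bot) (@IPC_andr _))).
Qed.

Lemma unbox_ax_top G s : iM G (unbox (subst s ax_top)).
Proof.
cbn. set (np := Neg (unbox (s 0))).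
do 2 apply calculus_deduction.
(* The goal is [Bot], since the negated conclusion was itself introduced as an implication. The
   assumption [Mod tri np] serves twice: here, and below to obtain [Mod tri Top]. *)
apply MP with (Mod tri np); [apply El; right; constructor |].
apply MP with (Mod tri Top).
- apply MP with (Mod tri np); [apply El; right; constructor |].
  (* [Top] unfolds to [Bot ~> Bot]. *)
  apply Mon, calculus_const, calculus_imp_refl.
- apply El. left. right. constructor.
Qed.

Lemma iM_WM G a : iM G a -> WM (boxed_set G) (boxed a).
Proof.
apply (calculus_map (f := boxed)).
- now split.
- intros H s b [].
- intros H m b c Hbc. now apply Mon.
- intros b Hb. now apply Im_intro with b.
Qed.

Lemma WM_IM G a : WM G a -> IM G a.
Proof.
apply (calculus_map (f := fun b => b)).
- now split.
- intros H s b Hb. apply AxR. exists b, s. split; [| reflexivity].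
  right. destruct Hb. constructor.
- intros H m b c Hbc. now apply Mon.
- trivial.
Qed.

Lemma IM_iM G a : IM (boxed_set G) (boxed a) -> iM G a.
Proof.
rewrite <- (unbox_boxed a) at 2. apply (calculus_map (f := unbox)).
- now split.
- intros H s b []; [apply unbox_ax_neg | apply unbox_ax_top].
- intros H [] b c Hbc; cbn.
  + now apply Mon.
  + now apply calculus_neg_mono, Mon, calculus_neg_mono.
(* Each premise in [boxed_set G] is sent back to the member of [G] it came from. *)
- intros b [c Hc d ->]. now rewrite unbox_boxed.
Qed.

Theorem theorem4p9 (G : Ensemble Ltri) (a : Ltri) :
  (iM G a <-> WM (boxed_set G) (boxed a)) /\
  (WM (boxed_set G) (boxed a) <-> IM (boxed_set G) (boxed a)).
Proof.
(* The three implications form a cycle. *)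
pose proof (@iM_WM G a). pose proof (@WM_IM (boxed_set G) (boxed a)).
pose proof (@IM_iM G a). tauto.
Qed.
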